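(* Let $A\in\mathbb{R}^{n\times n}$ be symmetric, $g\in\mathbb{R}^n$ nonzero, $\Delta>0$, and let $s_{opt}$ be the solution of the trust-region subproblem $\min_{\|s\|\le\Delta} g^Ts+\frac12 s^TAs$, in the easy case. Let $$M=\begin{pmatrix}-A & \frac{gg^T}{\Delta^2}\\ I & -A\end{pmatrix}\in\mathbb{R}^{2n\times 2n},$$ let $\mu_1$ be the rightmost eigenvalue of $M$ and $y$ a corresponding real unit eigenvector. Let $\mathcal{K}_k(v_1,M)$ be the $k$-dimensional Krylov subspace with orthonormal basis matrix $V_k$ generated by the Arnoldi process, let $H_k=V_k^TMV_k$, and let $(\mu_1^{(k)},y^{(k)})$ be the rightmost Ritz pair of $M$ with respect to $\mathcal{K}_k(v_1,M)$, with $\|y^{(k)}\|=1$ and $y^{(k)}=\begin{pmatrix}y_1^{(k)}\\ y_2^{(k)}\end{pmatrix}$. Let $s_A^{(k)}$ be the Arnoldi approximation $$s_A^{(k)}=-\frac{\Delta^2}{g^Ty_2^{(k)}}\,y_1^{(k)}=-\operatorname{sign}(g^Ty_2^{(k)})\,\Delta\,\frac{y_1^{(k)}}{\|y_1^{(k)}\|}$$ (both equalities being assumed to hold). Let $\varepsilon_k=\sin\angle(y,\mathcal{K}_k(v_1,M))$, $\pi_k=V_kV_k^T$, $\gamma_k=\|\pi_kM(I-\pi_k)\|$ and $\alpha=y^Ty^{(k)}$, and let $\kappa(\mu_1^{(k)})$ and the matrix $C_k$ be as defined in the context. Assume that $\|s_{opt}\|=\|s_A^{(k)}\|=\Delta$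 and that $\operatorname{sep}(\mu_1,C_k)>0$. Then, for $\varepsilon_k$ small, $$\|(A+\mu_1^{(k)}I)s_A^{(k)}+g\|\le c_k\,\varepsilon_k+\mathcal{O}(\varepsilon_k^2),$$ where $$c_k=\frac{\Delta}{\|y_1^{(k)}\|}\left(\|M-\mu_1^{(k)}I\|\left(1+\frac{\|M\|}{\sqrt{1-\varepsilon_k^2}\,\operatorname{sep}(\mu_1,C_k)}\right)+|\alpha|\,\kappa(\mu_1^{(k)})\,\gamma_k\right).$$
   Context: $\|\cdot\|$ is the 2-norm of a vector or matrix. ''Rightmost'' means having the largest real part. Easy case: it is not the case that both $g$ is orthogonal to the eigenspace of $A$ for its smallest eigenvalue $\alpha_n$ and the optimal Lagrange multiplier equals $-\alpha_n$. Here the optimal multiplier is the $\lambda_{opt}\ge0$ with $(A+\lambda_{opt}I)s_{opt}=-g$, $\lambda_{opt}(\Delta-\|s_{opt}\|)=0$ and $A+\lambda_{opt}I\succeq0$. It is known that, when $\|s_{opt}\|=\Delta$, the rightmost eigenvalue $\mu_1$ of $M$ is real and simple and equals $\lambda_{opt}$. Krylov subspace: $\mathcal{K}_k(v_1,M)=\operatorname{span}\{v_1,Mv_1,\dots,M^{k-1}v_1\}$ for a unit vector $v_1\in\mathbb{R}^{2n}$, assumed to have dimension $k$. $V_k\in\mathbb{R}^{2n\times k}$ has orthonormal columns spanning it, and $H_k=V_k^TMV_k\in\mathbb{R}^{k\times k}$ is the matrix representation of the restriction of $\pi_kM\pi_k$ to this subspace. Rightmost Ritz pair: $\mu_1^{(k)}$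 is the rightmost eigenvalue of $H_k$, used as the approximation to $\mu_1$, $z_1^{(k)}$ is an associated unit eigenvector, and $y^{(k)}=V_kz_1^{(k)}$; these quantities are taken to be real. The blocks $y_1^{(k)},y_2^{(k)}$ lie in $\mathbb{R}^n$, with $y_1^{(k)}\neq0$ and $g^Ty_2^{(k)}\neq0$. Matrix $C_k$: let the columns of $Z_\perp^{(k)}$ form an orthonormal basis of the orthogonal complement of $\operatorname{span}\{z_1^{(k)}\}$ in $\mathbb{R}^k$; then $C_k=(Z_\perp^{(k)})^TH_kZ_\perp^{(k)}$. Its eigenvalues are the Ritz values other than $\mu_1^{(k)}$. $\operatorname{sep}(\mu_1,C_k)=\sigma_{\min}(C_k-\mu_1I)$, the smallest singular value. $\angle(y,\mathcal{K})$ is the acute angle between $y$ and the subspace $\mathcal{K}$, so $\varepsilon_k=\|(I-\pi_k)y\|$. $\kappa(\mu_1^{(k)})$ is the spectral condition number of $\mu_1^{(k)}$ as a (simple) eigenvalue of $H_k$, i.e. $1/|u^Hz|$ for unit left and right eigenvectors $u,z$ of $H_k$ for $\mu_1^{(k)}$. $\mathcal{O}(\varepsilon_k^2)$ is understood in the sense of first-order eigenvalue perturbation theory: a second-order remainder, bounded by a constant times $\varepsilon_k^2$ for $\varepsilon_k$ small, where the constant may depend on $A,g,\Delta$ and on the spectral data of $H_k$. *)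

(* Defs.v *)
From HB Require Import structures.
From mathcomp Require Import all_boot all_order all_algebra.
From mathcomp Require Import all_classical all_reals all_analysis.
From mathcomp Require Import complex.

Set Implicit Arguments.
Unset Strict Implicit.
Unset Printing Implicit Defensive.

Import Order.TTheory GRing.Theory Num.Theory.

Local Open Scope classical_set_scope.
Local Open Scope ring_scope.

(* The library norm on matrices is the entrywise max norm, so the Euclidean
   norm and the operator 2-norm it induces are defined here. *)
Definition dotv (R : realType) n (u v : 'cV[R]_n) : R := (u^T *m v) ord0 ord0.

Definition norm2 (R : realType) n (v : 'cV[R]_n) : R := Num.sqrt (dotv v v).

Definition opnorm (R : realType) m n (B : 'M[R]_(m, n)) : R :=
  sup [set norm2 (B *m x) | x in [set x : 'cV[R]_n | norm2 x <= 1]].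

(* There are finitely many singular values, so the infimum is the smallest one.
   A matrix without columns has none, and then sigma_min is inf set0 = 0. *)
Definition singular_values (R : realType) m n (B : 'M[R]_(m, n)) : set R :=
  [set Num.sqrt a | a in [set a : R | eigenvalue (B^T *m B) a]].

Definition sigma_min (R : realType) m n (B : 'M[R]_(m, n)) : R :=
  inf (singular_values B).

Definition sep (R : realType) n (mu : R) (C : 'M[R]_n) : R :=
  sigma_min (C - mu%:M).

Definition possemidef (R : realType) n (B : 'M[R]_n) : Prop :=
  forall x : 'cV[R]_n, 0 <= dotv x (B *m x).

(* mathcomp's [eigenvalue] uses row eigenvectors; the eigenvalues are the same
   as with column eigenvectors. Competitors range over the complex spectrum. *)
Definition rightmost_eigenvalue (R : realType) n (B : 'M[R]_n) (mu : R) : Prop :=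
  eigenvalue B mu /\
  forall z : complex R,
    eigenvalue (map_mx (real_complex R) B) z -> complex.Re z <= mu.

Definition simple_eigenvalue (R : realType) n (B : 'M[R]_n) (mu : R) : Prop :=
  mup mu (char_poly B) = 1%N.

Definition unit_right_eigenvector (R : realType) n (B : 'M[R]_n) (mu : R)
    (z : 'cV[R]_n) : Prop :=
  norm2 z = 1 /\ B *m z = mu *: z.

Definition unit_left_eigenvector (R : realType) n (B : 'M[R]_n) (mu : R)
    (u : 'cV[R]_n) : Prop :=
  norm2 u = 1 /\ u^T *m B = mu *: u^T.

(* Spectral condition number of a simple eigenvalue, from unit left and right
   eigenvectors u and z; simplicity ensures that dotv u z != 0. *)
Definition eig_cond (R : realType) n (u z : 'cV[R]_n) : R := `|dotv u z|^-1.

Definition tr_objective (R : realType) n (A : 'M[R]_n) (g s : 'cV[R]_n) : R :=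
  dotv g s + 2^-1 * dotv s (A *m s).

Definition tr_solution (R : realType) n (A : 'M[R]_n) (g : 'cV[R]_n)
    (Delta : R) (s : 'cV[R]_n) : Prop :=
  norm2 s <= Delta /\
  forall t : 'cV[R]_n,
    norm2 t <= Delta -> tr_objective A g s <= tr_objective A g t.

Definition optimal_multiplier (R : realType) n (A : 'M[R]_n) (g : 'cV[R]_n)
    (Delta : R) (s : 'cV[R]_n) (lambda : R) : Prop :=
  [/\ 0 <= lambda,
      (A + lambda%:M) *m s = - g,
      lambda * (Delta - norm2 s) = 0 &
      possemidef (A + lambda%:M)].

Definition smallest_eigenvalue (R : realType) n (A : 'M[R]_n) (a : R) : Prop :=
  eigenvalue A a /\ forall b : R, eigenvalue A b -> a <= b.

Definition easy_case (R : realType) n (A : 'M[R]_n) (g : 'cV[R]_n)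
    (lambda : R) : Prop :=
  forall a : R, smallest_eigenvalue A a ->
    ~ ((forall v : 'cV[R]_n, A *m v = a *: v -> dotv g v = 0) /\ lambda = - a).

Definition trs_mx (R : realType) n (A : 'M[R]_n) (g : 'cV[R]_n) (Delta : R) :
    'M[R]_(n + n) :=
  block_mx (- A) ((Delta ^+ 2)^-1 *: (g *m g^T)) 1%:M (- A).

Definition krylov_mx (R : realType) n (M : 'M[R]_n) (v : 'cV[R]_n) (k : nat) :
    'M[R]_(n, k) :=
  \matrix_(i < n, j < k) (M ^+ j *m v) i ord0.

(* Column spaces are compared as row spaces of the transposes. *)
Definition orthonormal_krylov_basis (R : realType) n (M : 'M[R]_n)
    (v : 'cV[R]_n) k (V : 'M[R]_(n, k)) : Prop :=
  V^T *m V = 1%:M /\ (V^T :=: (krylov_mx M v k)^T)%MS.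

(* The rows of [kermx z] span the w^T with w^T *m z = 0. *)
Definition orthonormal_complement_basis (R : realType) k (z : 'cV[R]_k)
    (Z : 'M[R]_(k, k.-1)) : Prop :=
  Z^T *m Z = 1%:M /\ (Z^T :=: kermx z)%MS.

(* Angle between a nonzero vector y and the column space of V, for V with
   orthonormal columns: V *m V^T is the orthogonal projection. *)
Definition angle_subspace (R : realType) n k (y : 'cV[R]_n)
    (V : 'M[R]_(n, k)) : R :=
  acos (norm2 (V *m V^T *m y) / norm2 y).

(* Main.v *)
Require Import Defs.
From HB Require Import structures.
From mathcomp Require Import all_boot all_order all_algebra.
From mathcomp Require Import all_classical all_reals all_analysis.
From mathcomp Require Import complex ring lra.

(** Let r = (M - mu_k) y_k be the residual of the Ritz pair. Multiplying the
    first block row of M - mu_k by Delta^2 / g^T y_2 shows that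
    (A + mu_k) s_A + g is, up to that factor, the upper half of r, and the
    factor has absolute value Delta / |y_1| because |s_A| = Delta
    ([arnoldi_residual]). So everything reduces to bounding |r|.

    Split y_k = alpha y + (y_k - alpha y). Since M y = mu_1 y, this gives
      |r| <= |alpha| |mu_1 - mu_k| + |M - mu_k| |y_k - alpha y|,
    and both terms are controlled by one vector, w = V^T y, the coordinates in
    the Krylov basis of the projection of y. It is an approximate eigenvector of
    H: the residual H w - mu_1 w is - V^T M (I - pi) y, of norm at most
    gamma eps ([projected_residual_le]). Testing this residual in two ways
    yields the two estimates.
    - Against the orthogonal complement Z of the Ritz vector z, on which H acts
      as C: (C - mu_1) Z^T w has norm at most gamma eps, so
      |Z^T w| <= gamma eps / sep ([sep_complement_le]). By Pythagoras
      |y_k - alpha y|^2 = 1 - alpha^2 = eps^2 + |Z^T w|^2, which gives the first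
      term of c_k.
    - Against the left eigenvector u of H: |mu_1 - mu_k| |u^T w| <= gamma eps
      ([left_eigenvector_le]), while u^T w differs from alpha u^T z by at most
      |Z^T w|, and |alpha| = 1 - O(eps). Hence
      |mu_1 - mu_k| <= kappa gamma eps + O(eps^2), with an explicit constant
      ([eigenvalue_error]). No expansion of the spectrum of H is involved, which
      is why that constant depends only on |M| and on the bounds for kappa and
      sep. Simplicity of mu_k makes u^T z nonzero
      ([simple_left_right_neq0]), so that kappa is the true condition number.

    The remainder is multiplied by Delta / |y_1|, and a constant uniform in k
    needs a lower bound on |y_1|. For small eps this block is close to plus or
    minus the upper half of y, so it suffices that the latter is nonzero
    ([rightmost_usubmx_neq0]). In the easy case A + lambda_opt I is positive
    definite, and then lambda_opt is an eigenvalue of M, so mu_1 >= lambda_opt.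
    If the upper half of y vanished, the second block row of M y = mu_1 y would
    put the lower half in the kernel of A + mu_1 I, which is trivial.

    The singular value sigma_min enters through |B x| >= sigma_min(B) |x|
    ([sigma_min_le]), a consequence of the spectral theorem for B^T B. *)

Set Implicit Arguments.
Unset Strict Implicit.
Unset Printing Implicit Defensive.

Import Order.TTheory GRing.Theory Num.Theory.

Local Open Scope ring_scope.

(** * Euclidean and operator norms *)

Section Euclidean.
Variable R : realType.
Implicit Types (m n : nat) (a : R).

Lemma dotvE n (u v : 'cV[R]_n) : dotv u v = \sum_i u i ord0 * v i ord0.
Proof. by rewrite /dotv mxE; apply: eq_bigr => i _; rewrite mxE. Qed.

Lemma dotvC n (u v : 'cV[R]_n) : dotv u v = dotv v u.
Proof. by rewrite !dotvE; apply: eq_bigr => i _; rewrite mulrC. Qed.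

Lemma dotvDr n (u v w : 'cV[R]_n) : dotv u (v + w) = dotv u v + dotv u w.
Proof. by rewrite /dotv mulmxDr mxE. Qed.

Lemma dotvZr n a (u v : 'cV[R]_n) : dotv u (a *: v) = a * dotv u v.
Proof. by rewrite /dotv -scalemxAr mxE. Qed.

Lemma dotvNr n (u v : 'cV[R]_n) : dotv u (- v) = - dotv u v.
Proof. by rewrite -scaleN1r dotvZr mulN1r. Qed.

Lemma dotvDl n (u v w : 'cV[R]_n) : dotv (u + v) w = dotv u w + dotv v w.
Proof. by rewrite !(dotvC _ w) dotvDr. Qed.

Lemma dotvZl n a (u v : 'cV[R]_n) : dotv (a *: u) v = a * dotv u v.
Proof. by rewrite dotvC dotvZr dotvC. Qed.

Lemma dotvNl n (u v : 'cV[R]_n) : dotv (- u) v = - dotv u v.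
Proof. by rewrite dotvC dotvNr dotvC. Qed.

Definition dotv_bilin := (dotvDl, dotvDr, dotvNl, dotvNr, dotvZl, dotvZr).

Lemma dotv0 n (u : 'cV[R]_n) : dotv u 0 = 0.
Proof. by rewrite -(scale0r 0) dotvZr mul0r. Qed.

Lemma dotv_mulmxr m n (B : 'M[R]_(m, n)) u v :
  dotv u (B *m v) = dotv (B^T *m u) v.
Proof. by rewrite /dotv trmx_mul trmxK mulmxA. Qed.

Lemma dotvv_ge0 n (v : 'cV[R]_n) : 0 <= dotv v v.
Proof. by rewrite dotvE sumr_ge0 // => i _; rewrite -expr2 sqr_ge0. Qed.

Lemma dotvv_eq0 n (v : 'cV[R]_n) : (dotv v v == 0) = (v == 0).
Proof.
apply/idP/eqP => [|->]; last by rewrite dotv0.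
rewrite dotvE psumr_eq0 => [/allP v0|i _]; last by rewrite -expr2 sqr_ge0.
apply/colP => i; have /implyP/(_ isT) := v0 i (mem_index_enum i).
by rewrite mxE mulf_eq0 orbb => /eqP.
Qed.

Lemma norm2_ge0 n (v : 'cV[R]_n) : 0 <= norm2 v.
Proof. exact: sqrtr_ge0. Qed.

Lemma norm2_sqr n (v : 'cV[R]_n) : norm2 v ^+ 2 = dotv v v.
Proof. by rewrite sqr_sqrtr // dotvv_ge0. Qed.

Lemma norm2_eq0 n (v : 'cV[R]_n) : (norm2 v == 0) = (v == 0).
Proof. by rewrite -dotvv_eq0 -norm2_sqr sqrf_eq0. Qed.

Lemma norm2_0 n : norm2 (0 : 'cV[R]_n) = 0.
Proof. by apply/eqP; rewrite norm2_eq0. Qed.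

Lemma norm2_gt0 n (v : 'cV[R]_n) : (0 < norm2 v) = (v != 0).
Proof. by rewrite lt_def norm2_eq0 norm2_ge0 andbT. Qed.

Lemma le_norm2 m n (u : 'cV[R]_m) (v : 'cV[R]_n) :
  (norm2 u <= norm2 v) = (dotv u u <= dotv v v).
Proof. by rewrite /norm2 ler_sqrt // dotvv_ge0. Qed.

Lemma norm2Z n a (v : 'cV[R]_n) : norm2 (a *: v) = `|a| * norm2 v.
Proof.
by rewrite /norm2 !dotv_bilin mulrA -expr2 sqrtrM ?sqr_ge0 // sqrtr_sqr.
Qed.

Lemma norm2N n (v : 'cV[R]_n) : norm2 (- v) = norm2 v.
Proof. by rewrite -scaleN1r norm2Z normrN normr1 mul1r. Qed.

Lemma cauchy_schwarz n (u v : 'cV[R]_n) : `|dotv u v| <= norm2 u * norm2 v.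
Proof.
have [->|v0] := eqVneq v 0; first by rewrite dotv0 norm2_0 normr0 mulr0.
have vv0 : 0 < dotv v v by rewrite lt_def dotvv_eq0 v0 dotvv_ge0.
rewrite -(@ler_pXn2r _ 2%N) ?nnegrE ?mulr_ge0 ?norm2_ge0 //.
rewrite real_normK ?num_real // exprMn !norm2_sqr.
(* The component of u orthogonal to v, scaled by dotv v v to avoid division. *)
have := dotvv_ge0 (dotv v v *: u - dotv u v *: v).
rewrite !dotv_bilin (dotvC v u) => h.
rewrite -subr_ge0 -(pmulr_rge0 _ vv0); apply: le_trans h _.
by rewrite le_eqVlt; apply/orP; left; apply/eqP; ring.
Qed.

Lemma norm2D n (u v : 'cV[R]_n) : norm2 (u + v) <= norm2 u + norm2 v.
Proof.
rewrite -(@ler_pXn2r _ 2%N) ?nnegrE ?addr_ge0 ?norm2_ge0 //.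
rewrite sqrrD !norm2_sqr !dotv_bilin (dotvC v u).
have := le_trans (ler_norm _) (cauchy_schwarz u v); lra.
Qed.

Lemma norm2_sub_le n (u v : 'cV[R]_n) : norm2 u - norm2 v <= norm2 (u - v).
Proof. by rewrite lerBlDr; have := norm2D (u - v) v; rewrite subrK. Qed.

Lemma dotv_col_mx m n (u1 v1 : 'cV[R]_m) (u2 v2 : 'cV[R]_n) :
  dotv (col_mx u1 u2) (col_mx v1 v2) = dotv u1 v1 + dotv u2 v2.
Proof. by rewrite /dotv tr_col_mx mul_row_col mxE. Qed.

Lemma norm2_usubmx m n (v : 'cV[R]_(m + n)) : norm2 (usubmx v) <= norm2 v.
Proof. by rewrite -{2}(vsubmxK v) le_norm2 dotv_col_mx lerDl dotvv_ge0. Qed.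

Lemma norm2_isometry m n (V : 'M[R]_(m, n)) x :
  V^T *m V = 1%:M -> norm2 (V *m x) = norm2 x.
Proof. by move=> VV; rewrite /norm2 dotv_mulmxr mulmxA VV mul1mx. Qed.

Lemma pythagoras_proj m n (V : 'M[R]_(m, n)) x : V^T *m V = 1%:M ->
  norm2 x ^+ 2 = norm2 (V^T *m x) ^+ 2 + norm2 ((1%:M - V *m V^T) *m x) ^+ 2.
Proof.
move=> VV; rewrite !norm2_sqr mulmxBl mul1mx -mulmxA.
rewrite !dotv_bilin ![dotv _ (V *m _)]dotv_mulmxr (mulmxA V^T) VV mul1mx.
rewrite [dotv (V *m _) x]dotvC [dotv x (V *m _)]dotv_mulmxr; ring.
Qed.

Lemma norm2_proj_le m n (V : 'M[R]_(m, n)) x : V^T *m V = 1%:M ->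
  norm2 (V^T *m x) <= norm2 x.
Proof.
move=> VV; rewrite -(@ler_pXn2r _ 2%N) ?nnegrE ?norm2_ge0 //.
by rewrite (pythagoras_proj x VV) lerDl sqr_ge0.
Qed.

Lemma norm2_coproj_le m n (V : 'M[R]_(m, n)) x : V^T *m V = 1%:M ->
  norm2 ((1%:M - V *m V^T) *m x) <= norm2 x.
Proof.
move=> VV; rewrite -(@ler_pXn2r _ 2%N) ?nnegrE ?norm2_ge0 //.
by rewrite (pythagoras_proj x VV) lerDr sqr_ge0.
Qed.

(** [opnorm] is a supremum, and a supremum of an unbounded set is 0; any bound,
    here the Frobenius norm, shows that it has the expected meaning. *)
Lemma mulmx_frobenius m n (B : 'M[R]_(m, n)) x :
  norm2 (B *m x) <=
    Num.sqrt (\sum_i dotv (row i B)^T (row i B)^T) * norm2 x.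
Proof.
have F0 : 0 <= \sum_i dotv (row i B)^T (row i B)^T.
  by apply: sumr_ge0 => i _; exact: dotvv_ge0.
rewrite -(@ler_pXn2r _ 2%N) ?nnegrE ?mulr_ge0 ?norm2_ge0 ?sqrtr_ge0 //.
rewrite exprMn !norm2_sqr sqr_sqrtr // dotvE mulr_suml; apply: ler_sum => i _.
have -> : (B *m x) i ord0 = dotv (row i B)^T x.
  by rewrite dotvE mxE; apply: eq_bigr => j _; rewrite !mxE.
rewrite -expr2 -[_ ^+ 2]real_normK ?num_real // -!norm2_sqr -exprMn.
by rewrite ler_pXn2r ?nnegrE ?mulr_ge0 ?norm2_ge0 // cauchy_schwarz.
Qed.

Local Open Scope classical_set_scope.

Let ball_image m n (B : 'M[R]_(m, n)) :=
  [set norm2 (B *m x) | x in [set x : 'cV[R]_n | norm2 x <= 1]].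

Let ball_image0 m n (B : 'M[R]_(m, n)) : ball_image B 0.
Proof. by exists 0; rewrite /= ?mulmx0 norm2_0. Qed.

Let ball_image_sup m n (B : 'M[R]_(m, n)) : has_sup (ball_image B).
Proof.
split; first by exists 0; exact: ball_image0.
exists (Num.sqrt (\sum_i dotv (row i B)^T (row i B)^T)) => _ [x /= x1 <-].
by apply: le_trans (mulmx_frobenius B x) _; rewrite ler_piMr ?sqrtr_ge0.
Qed.

Lemma opnorm_ge0 m n (B : 'M[R]_(m, n)) : 0 <= opnorm B.
Proof. exact: (ub_le_sup (ball_image_sup B).2 (ball_image0 B)). Qed.

Lemma norm2_mulmx m n (B : 'M[R]_(m, n)) x :
  norm2 (B *m x) <= opnorm B * norm2 x.
Proof.
have [->|x0] := eqVneq x 0; first by rewrite mulmx0 !norm2_0 mulr0.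
have xpos : 0 < norm2 x by rewrite norm2_gt0.
have sup_ge y : norm2 y <= 1 -> norm2 (B *m y) <= opnorm B.
  by move=> y1; apply: (ub_le_sup (ball_image_sup B).2); exists y.
have := sup_ge ((norm2 x)^-1 *: x).
rewrite -scalemxAr !norm2Z gtr0_norm ?invr_gt0 // mulVf ?gt_eqF //.
by move=> /(_ (lexx _)); rewrite mulrC ler_pdivrMr.
Qed.

Lemma opnorm_le m n (B : 'M[R]_(m, n)) c : 0 <= c ->
  (forall x, norm2 (B *m x) <= c * norm2 x) -> opnorm B <= c.
Proof.
move=> c0 Bc; apply: ge_sup; first by exists 0; exact: ball_image0.
by move=> _ [x /= x1 <-]; apply: le_trans (Bc x) _; rewrite ler_piMr.
Qed.

Local Close Scope classical_set_scope.
End Euclidean.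

(** * Symmetric matrices and singular values *)

Section Spectral.
Variable R : realType.

Lemma eigenvalue_trmx n (B : 'M[R]_n) a : eigenvalue B^T a = eigenvalue B a.
Proof.
rewrite !eigenvalue_root_char; congr (root _ a); rewrite /char_poly -det_tr.
by congr (\det _); apply/matrixP => i j; rewrite !mxE eq_sym.
Qed.

Lemma col_eigenvalue n (B : 'M[R]_n) a (x : 'cV[R]_n) :
  B *m x = a *: x -> x != 0 -> eigenvalue B a.
Proof.
move=> Bx x0; rewrite -eigenvalue_trmx; apply/eigenvalueP; exists x^T.
  by rewrite -trmx_mul Bx linearZ.
by rewrite trmx_eq0.
Qed.

(** G is diagonalized unitarily over R[i]; there its real quadratic form is a
    combination of squared moduli weighted by the eigenvalues of G. *)
Lemma rayleigh_ge n (G : 'M[R]_n) (s : R) : G^T = G ->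
  (forall a, eigenvalue G a -> s <= a) ->
  forall x, s * dotv x x <= dotv x (G *m x).
Proof.
move=> GT sle x.
pose f := real_complex R.
have fT m p (B : 'M[R]_(m, p)) :
    map_mx Num.conj (map_mx f B)^T = (map_mx f B)^T.
  apply/matrixP => i j; rewrite !mxE; apply/conj_Creal/complex_realP.
  by exists (B j i).
pose Gc := map_mx f G.
have Gherm : Gc \is hermsymmx.
  apply: realsym_hermsym.
    by apply/is_hermitianmxP; rewrite /= expr0 scale1r map_mx_id // map_trmx GT.
  by apply/mxOverP => i j; rewrite mxE; apply/complex_realP; exists (G i j).
have Gdec : Gc =
    invmx (spectralmx Gc) *m diag_mx (spectral_diag Gc) *m spectralmx Gc.
  exact/orthomx_spectralP/hermitian_normalmx.
have dreal := mxOverP (hermitian_spectral_diag_real Gherm) ord0.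
have /unitarymxP PP := spectral_unitarymx Gc.
have Pinv : invmx (spectralmx Gc) = map_mx Num.conj (spectralmx Gc)^T.
  exact: invmx_unitary (spectral_unitarymx Gc).
have Pu := spectral_unit Gc.
set P := spectralmx Gc in Gdec PP Pinv Pu.
set d := spectral_diag Gc in Gdec dreal.
pose p := P *m map_mx f x.
have px : map_mx Num.conj p^T = (map_mx f x)^T *m invmx P.
  by rewrite trmx_mul map_mxM fT Pinv.
have inner m (u v : 'cV[R]_m) :
    f (dotv u v) = ((map_mx f u)^T *m map_mx f v) ord0 ord0.
  by rewrite map_trmx -map_mxM [RHS]mxE.
(* p holds the coordinates of x in the eigenbasis. *)
have n1 : f (dotv x x) = \sum_i `|p i ord0| ^+ 2.
  rewrite inner -[X in _ *m X](mulKmx Pu) -/p (mulmxA (map_mx f x)^T) -px mxE.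
  by apply: eq_bigr => i _; rewrite !mxE normCKC.
have n2 : f (dotv x (G *m x)) = \sum_i d ord0 i * `|p i ord0| ^+ 2.
  rewrite inner map_mxM -/Gc Gdec -!mulmxA -/p (mulmxA (map_mx f x)^T) -px mxE.
  apply: eq_bigr => i _; rewrite mul_diag_mx !mxE normCKC; ring.
(* Row i of P is a complex eigenvector; its eigenvalue is real, hence is an
   eigenvalue of G over R. *)
have dge i : f s <= d ord0 i.
  have /complex_realP [r dr] := dreal i; rewrite dr lecR; apply: sle.
  rewrite -(eigenvalue_map f) -/Gc /f /= -dr; apply/eigenvalueP.
  exists (row i P); last first.
    apply/eqP => /(congr1 (mulmx^~ (invmx P))); rewrite mul0mx -row_mul mulmxV //.
    by move/rowP/(_ i); rewrite !mxE eqxx => /eqP; rewrite oner_eq0.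
  rewrite Gdec -row_mul !mulmxA mulmxV // mul1mx; apply/rowP => j.
  by rewrite mul_diag_mx !mxE.
have fM (a b : R) : f (a * b) = f a * f b by exact: rmorphM.
rewrite -lecR -!/(f _) fM n1 n2 mulr_sumr; apply: ler_sum => i _.
by rewrite ler_wpM2r // exprn_ge0.
Qed.

Lemma sigma_min_le m n (B : 'M[R]_(m, n)) x :
  sigma_min B * norm2 x <= norm2 (B *m x).
Proof.
have [s0|s0] := leP 0 (sigma_min B); last first.
  by apply: le_trans (norm2_ge0 _); rewrite nmulr_rle0 // norm2_ge0.
rewrite -(@ler_pXn2r _ 2%N) ?nnegrE ?mulr_ge0 ?norm2_ge0 //.
rewrite exprMn !norm2_sqr dotv_mulmxr mulmxA dotvC.
apply: rayleigh_ge => [|a aB]; first by rewrite trmx_mul trmxK.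
have sa : sigma_min B <= Num.sqrt a.
  apply: ge_inf; last by exists a.
  by exists 0 => _ [b _ <-]; exact: sqrtr_ge0.
have a0 : 0 <= a.
  have /eigenvalueP [v va v0] := aB.
  have gv : B^T *m B *m v^T = a *: v^T.
    by rewrite -linearZ -va /= !trmx_mul trmxK.
  have vT0 : 0 < dotv v^T v^T by rewrite lt_def dotvv_ge0 dotvv_eq0 trmx_eq0 v0.
  have : 0 <= dotv (B *m v^T) (B *m v^T) := dotvv_ge0 _.
  by rewrite dotv_mulmxr mulmxA gv dotvZl pmulr_lge0.
by rewrite -[leRHS](sqr_sqrtr a0) ler_pXn2r ?nnegrE ?sqrtr_ge0.
Qed.

End Spectral.

(** * Block form of a matrix in a basis completing an eigenvector *)

Section SimpleEigenvalue.
Variable R : realType.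

Lemma char_poly_ublock m n (a : 'M[R]_m) (b : 'M[R]_(m, n)) (c : 'M[R]_n) :
  char_poly (block_mx a b 0 c) = char_poly a * char_poly c.
Proof.
rewrite /char_poly /char_poly_mx map_block_mx map_mx0 scalar_mx_block.
by rewrite opp_block_mx add_block_mx subr0 det_ublock.
Qed.

Lemma char_poly_orthogonal n (Q H : 'M[R]_n) :
  Q^T *m Q = 1%:M -> char_poly (Q^T *m H *m Q) = char_poly H.
Proof.
move=> QQ; rewrite /char_poly.
have -> : char_poly_mx (Q^T *m H *m Q) =
    map_mx polyC Q^T *m char_poly_mx H *m map_mx polyC Q.
  rewrite /char_poly_mx mulmxBr mulmxBl !map_mxM; congr (_ - _).
  by rewrite scalar_mxC -mulmxA -map_mxM QQ map_mx1 mulmx1.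
rewrite !det_mulmx mulrC mulrA -det_mulmx -map_mxM (mulmx1C QQ).
by rewrite map_mx1 det1 mul1r.
Qed.

Lemma unit_vector_dim_gt0 k (z : 'cV[R]_k) : norm2 z = 1 -> (0 < k)%N.
Proof.
case: k z => // z z1; have : norm2 z = 0 by rewrite [z]flatmx0 norm2_0.
by rewrite z1 => /eqP; rewrite oner_eq0.
Qed.

Lemma complement_basis_orth k (z : 'cV[R]_k) (Z : 'M[R]_(k, k.-1)) :
  orthonormal_complement_basis z Z -> Z^T *m z = 0.
Proof. by case=> _ Zk; apply/sub_kermxP; rewrite Zk. Qed.

(** Splitting k.+1 as 1 + k makes the matrix with blocks z and Z square, so that
    its transpose is also a right inverse; this is the completeness relation
    behind [complement_basis_decomp]. *)
Lemma complement_basis_orthonormal k (z : 'cV[R]_k.+1) (Z : 'M[R]_(k.+1, k)) :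
  norm2 z = 1 -> orthonormal_complement_basis z Z ->
  (row_mx z Z : 'M[R]_(k.+1, 1 + k))^T *m row_mx z Z = 1%:M.
Proof.
move=> z1 hZ; have Zz := complement_basis_orth hZ; case: hZ => ZZ _.
rewrite tr_row_mx mul_col_row Zz ZZ -[z^T *m Z]trmxK trmx_mul trmxK Zz trmx0.
rewrite [z^T *m z]mx11_scalar -[_ ord0 ord0]/(dotv z z) -norm2_sqr z1 expr1n.
by rewrite -scalar_mx_block.
Qed.

Lemma complement_basis_decomp k (z : 'cV[R]_k) (Z : 'M[R]_(k, k.-1)) x :
  norm2 z = 1 -> orthonormal_complement_basis z Z ->
  x = dotv z x *: z + Z *m (Z^T *m x).
Proof.
move=> z1; have := unit_vector_dim_gt0 z1.
case: k z Z x z1 => // k z Z x z1 _ hZ.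
rewrite -[LHS]mul1mx -(mulmx1C (complement_basis_orthonormal z1 hZ)).
rewrite tr_row_mx mul_row_col mulmxDl -!mulmxA; congr (_ + _).
by rewrite [z^T *m x]mx11_scalar mul_mx_scalar.
Qed.

Lemma complement_basis_norm k (z : 'cV[R]_k) (Z : 'M[R]_(k, k.-1)) x :
  norm2 z = 1 -> orthonormal_complement_basis z Z ->
  norm2 x ^+ 2 = dotv z x ^+ 2 + norm2 (Z^T *m x) ^+ 2.
Proof.
move=> z1 hZ; rewrite !norm2_sqr {1}(complement_basis_decomp x z1 hZ).
rewrite dotvDl dotvZl -expr2; congr (_ + _).
by rewrite dotvC dotv_mulmxr.
Qed.

(** H z is parallel to z, which Z^T kills: the complement is invariant modulo z,
    and C represents the induced map. *)
Lemma compression_left_mul k (H : 'M[R]_k) mu z (Z : 'M[R]_(k, k.-1))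
    (x : 'cV[R]_k) :
  unit_right_eigenvector H mu z -> orthonormal_complement_basis z Z ->
  Z^T *m (H *m x) = (Z^T *m H *m Z) *m (Z^T *m x).
Proof.
move=> [z1 Hz] hZ.
rewrite [in LHS](complement_basis_decomp x z1 hZ) !mulmxDr -!scalemxAr Hz.
by rewrite -scalemxAr (complement_basis_orth hZ) !scaler0 add0r !mulmxA.
Qed.

(** In the basis (z, Z), H is block triangular with diagonal blocks mu and C. If
    u were orthogonal to z, then u^T Z would be a left eigenvector of C for mu,
    and mu would be a root of the characteristic polynomial twice. *)
Lemma simple_left_right_neq0 k (H : 'M[R]_k) mu u z (Z : 'M[R]_(k, k.-1)) :
  simple_eigenvalue H mu -> unit_right_eigenvector H mu z ->
  unit_left_eigenvector H mu u -> orthonormal_complement_basis z Z ->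
  dotv u z != 0.
Proof.
move=> + hz hu hZ; have [z1 Hz] := hz; have [u1 Hu] := hu.
move: (unit_vector_dim_gt0 z1) hZ; case: k H u z Z hz hu z1 Hz u1 Hu => // k.
move=> H u z Z hz _ z1 Hz u1 Hu _ hZ simple; apply/eqP => uz.
pose C := Z^T *m H *m Z.
have charH : char_poly H = ('X - mu%:P) * char_poly C.
  pose Q : 'M[R]_(1 + k) := row_mx (z : 'M[R]_(1 + k, 1)) (Z : 'M[R]_(1 + k, k)).
  have <- : char_poly (Q^T *m (H : 'M[R]_(1 + k)) *m Q) = char_poly H.
    exact: char_poly_orthogonal (complement_basis_orthonormal z1 hZ).
  rewrite tr_row_mx mul_col_mx mul_col_row -!mulmxA Hz -!scalemxAr.
  rewrite (complement_basis_orth hZ) scaler0 [z^T *m z]mx11_scalar.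
  rewrite -[_ ord0 ord0]/(dotv z z) -norm2_sqr z1 expr1n.
  rewrite char_poly_ublock mulmxA scale_scalar_mx mulr1; congr (_ * _).
  by rewrite /char_poly det_mx11 !mxE.
have rootC : root (char_poly C) mu.
  rewrite -eigenvalue_root_char; apply/eigenvalueP.
  have uD := complement_basis_decomp u z1 hZ.
  rewrite dotvC uz scale0r add0r in uD.
  exists (u^T *m Z).
    have uZZ : u^T *m Z *m Z^T = u^T.
      by apply: trmx_inj; rewrite !trmx_mul !trmxK -uD.
    by rewrite /C !mulmxA uZZ Hu -scalemxAl.
  apply/eqP => /(congr1 trmx); rewrite trmx_mul trmxK trmx0 => Zu.
  move: u1; rewrite uD Zu mulmx0 norm2_0 => /eqP.
  by rewrite eq_sym oner_eq0.
have C0 : char_poly C != 0 by rewrite monic_neq0 // char_poly_monic.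
move: simple; rewrite /simple_eigenvalue charH mupM ?polyXsubC_eq0 //.
rewrite -(expr1 ('X - _)) mup_XsubCX eqxx.
have : (0 < mup mu (char_poly C))%N by rewrite -XsubC_dvd // dvdp_XsubCl.
by case: (mup _ _).
Qed.

End SimpleEigenvalue.

(** * The trust-region matrix in the easy case *)

Section TrustRegion.
Variables (R : realType) (n : nat) (A : 'M[R]_n) (g : 'cV[R]_n).
Variables (Delta : R) (s : 'cV[R]_n) (lambda : R).

Lemma shift_mulmx a (x : 'cV[R]_n) : (A + a%:M) *m x = A *m x + a *: x.
Proof. by rewrite mulmxDl mul_scalar_mx. Qed.

(** A nonzero kernel vector would make -lambda the smallest eigenvalue of A. But
    g lies in the image of the symmetric matrix A + lambda I, hence is
    orthogonal to its kernel: this is the hard case. *)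
Lemma easy_case_injective (x : 'cV[R]_n) : A^T = A ->
  optimal_multiplier A g Delta s lambda -> easy_case A g lambda ->
  (A + lambda%:M) *m x = 0 -> x = 0.
Proof.
move=> AT [_ As _ psd] easy Ax; apply/eqP; case: (eqVneq x 0) => // x0.
have Axl : A *m x = - lambda *: x.
  by apply/eqP; rewrite scaleNr -subr_eq0 opprK -shift_mulmx Ax.
case: (easy (- lambda)); last split; last by rewrite opprK.
  split; first exact: col_eigenvalue Axl x0.
  move=> b; rewrite -eigenvalue_trmx AT => /eigenvalueP [v vA v0].
  have vv : 0 < dotv v^T v^T by rewrite lt_def dotvv_ge0 dotvv_eq0 trmx_eq0 v0.
  have Av : A *m v^T = b *: v^T by rewrite -linearZ -vA /= trmx_mul AT.
  have := psd v^T.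
  by rewrite shift_mulmx Av -scalerDl dotvZr pmulr_lge0 // -lerBlDr sub0r.
move=> v Av; have -> : g = - ((A + lambda%:M) *m s) by rewrite As opprK.
have ST : (A + lambda%:M)^T = A + lambda%:M by rewrite linearD /= AT tr_scalar_mx.
rewrite dotvNl dotvC dotv_mulmxr ST shift_mulmx Av -scalerDl addNr scale0r.
by rewrite dotvC dotv0 oppr0.
Qed.

Lemma trs_mx_mul (a b : 'cV[R]_n) :
  trs_mx A g Delta *m col_mx a b =
  col_mx (- (A *m a) + (dotv g b / Delta ^+ 2) *: g) (a - A *m b).
Proof.
rewrite /trs_mx mul_block_col mul1mx !mulNmx; congr (col_mx (_ + _) _).
rewrite -scalemxAl -mulmxA [g^T *m b]mx11_scalar mul_mx_scalar scalerA.
by rewrite mulrC.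
Qed.

(** With S = A + lambda I invertible, (s, S^-1 s) is an eigenvector: the second
    block row is S b = s, and in the first one
    g^T b = - s^T S S^-1 s = - Delta^2 turns the rank-one block into - g = S s. *)
Lemma multiplier_eigenvalue_trs_mx : A^T = A -> g != 0 -> 0 < Delta ->
  optimal_multiplier A g Delta s lambda -> easy_case A g lambda ->
  norm2 s = Delta -> eigenvalue (trs_mx A g Delta) lambda.
Proof.
move=> AT g0 D0 opt easy sD; pose S := A + lambda%:M.
have Sinj (x : 'cV[R]_n) : S *m x = 0 -> x = 0 by exact: easy_case_injective opt easy.
have Sg : S *m s = - g by case: opt.
have ST : S^T = S by rewrite linearD /= AT tr_scalar_mx.
have Su : S \in unitmx.
  rewrite -row_free_unit; apply/inj_row_free => v vS.
  by apply: trmx_inj; rewrite trmx0; apply: Sinj; rewrite -ST -trmx_mul vS trmx0.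
pose b := invmx S *m s.
have Sb : S *m b = s by rewrite mulKVmx.
have gb : dotv g b = - Delta ^+ 2.
  have -> : g = - (S *m s) by rewrite Sg opprK.
  by rewrite dotvNl dotvC dotv_mulmxr ST Sb -norm2_sqr sD.
apply: (@col_eigenvalue _ _ _ _ (col_mx s b)).
  rewrite trs_mx_mul gb mulNr divff ?expf_neq0 ?gt_eqF // scaleN1r scale_col_mx.
  congr col_mx.
    by apply/eqP; rewrite -Sg shift_mulmx addKr.
  by rewrite -{1}Sb shift_mulmx addrAC subrr add0r.
apply/eqP => /(congr1 usubmx); rewrite col_mxKu linear0 => s0.
by move: D0; rewrite -sD s0 norm2_0 ltxx.
Qed.

(** A + mu I is at least as positive as A + lambda I because mu >= lambda, so it
    is injective too, and an eigenvector with zero upper half would vanish. *)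
Lemma rightmost_usubmx_neq0 mu (y : 'cV[R]_(n + n)) :
  A^T = A -> g != 0 -> 0 < Delta ->
  optimal_multiplier A g Delta s lambda -> easy_case A g lambda ->
  norm2 s = Delta -> rightmost_eigenvalue (trs_mx A g Delta) mu ->
  unit_right_eigenvector (trs_mx A g Delta) mu y -> usubmx y != 0.
Proof.
move=> AT g0 D0 opt easy sD [_ right] [y1 My]; apply/eqP => yu.
have le_mu : lambda <= mu.
  have := right (real_complex R lambda).
  by rewrite eigenvalue_map; apply; exact: multiplier_eigenvalue_trs_mx.
move: My; rewrite -(vsubmxK y) yu trs_mx_mul scale_col_mx sub0r.
move=> /eq_col_mx [_ /eqP]; rewrite eq_sym -addr_eq0 addrC -shift_mulmx => /eqP Sy.
set b := dsubmx y in Sy.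
have b0 : b = 0.
  case: (eqVneq lambda mu) => [lm|lm].
    by apply: (easy_case_injective AT opt easy); rewrite lm.
  have lt_mu : 0 < mu - lambda by rewrite subr_gt0 lt_def eq_sym lm.
  case: opt => _ _ _ /(_ b).
  have -> : (A + lambda%:M) *m b = - ((mu - lambda) *: b).
    move/eqP: Sy; rewrite !shift_mulmx addr_eq0 => /eqP ->.
    by rewrite scalerBl opprB addrC.
  rewrite dotvNr dotvZr oppr_ge0 pmulr_rle0 // => bb.
  by apply/eqP; rewrite -dotvv_eq0 eq_le bb dotvv_ge0.
move: y1; rewrite -(vsubmxK y) yu -/b b0 col_mx0 norm2_0 => /eqP.
by rewrite eq_sym oner_eq0.
Qed.

(** The scaling in s_A is the one that turns the rank-one block of M into g. *)
Lemma arnoldi_residual mu (x : 'cV[R]_(n + n)) (sA : 'cV[R]_n) :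
  0 < Delta -> usubmx x != 0 -> dotv g (dsubmx x) != 0 ->
  sA = - (Delta ^+ 2 / dotv g (dsubmx x)) *: usubmx x -> norm2 sA = Delta ->
  norm2 ((A + mu%:M) *m sA + g) <=
    Delta / norm2 (usubmx x) * norm2 ((trs_mx A g Delta - mu%:M) *m x).
Proof.
move=> D0 x1 gx sAE sAD; set c := Delta ^+ 2 / _ in sAE.
have -> : (A + mu%:M) *m sA + g = c *: usubmx ((trs_mx A g Delta - mu%:M) *m x).
  rewrite mulmxBl mul_scalar_mx linearB linearZ /=.
  rewrite -[in trs_mx _ _ _ *m x](vsubmxK x).
  rewrite trs_mx_mul col_mxKu sAE -scalemxAr shift_mulmx.
  have cV : c * (dotv g (dsubmx x) / Delta ^+ 2) = 1.
    by rewrite mulrA divfK // divff // expf_neq0 // gt_eqF.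
  rewrite addrAC [in RHS]scalerDr scalerA cV scale1r; congr (_ + _).
  by rewrite -opprD scalerN scaleNr.
have -> : Delta / norm2 (usubmx x) = `|c|.
  by rewrite -sAD sAE norm2Z normrN mulfK ?norm2_eq0.
by rewrite norm2Z ler_wpM2l // norm2_usubmx.
Qed.

End TrustRegion.

(** * Error of a Ritz pair *)

Section RitzPair.
Variables (R : realType) (N k : nat) (M : 'M[R]_N) (V : 'M[R]_(N, k)).
Variables (mu1 muk : R) (y : 'cV[R]_N) (z : 'cV[R]_k) (Z : 'M[R]_(k, k.-1)).
Hypothesis VV : V^T *m V = 1%:M.
Hypothesis yP : unit_right_eigenvector M mu1 y.
Let H := V^T *m M *m V.
Hypothesis zP : unit_right_eigenvector H muk z.
Hypothesis ZP : orthonormal_complement_basis z Z.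
Let w := V^T *m y.
Let eps := norm2 ((1%:M - V *m V^T) *m y).
Let gamma := opnorm (V *m V^T *m M *m (1%:M - V *m V^T)).
Let alpha := dotv y (V *m z).
Let r := H *m w - mu1 *: w.

Lemma sin_angle_subspace : sin (angle_subspace y V) = eps.
Proof.
have [y1 _] := yP; rewrite /angle_subspace y1 divr1 -mulmxA norm2_isometry //.
have := pythagoras_proj y VV; rewrite y1 expr1n -/eps => pyth.
rewrite sin_acos; last first.
  rewrite (le_trans _ (norm2_ge0 _)) ?lerN10 //=.
  by have := norm2_proj_le y VV; rewrite y1.
have -> : 1 - norm2 (V^T *m y) ^+ 2 = eps ^+ 2 by rewrite pyth addrAC subrr add0r.
by rewrite sqrtr_sqr ger0_norm // norm2_ge0.
Qed.

Lemma opnorm_coupling_le : gamma <= opnorm M.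
Proof.
apply: opnorm_le (opnorm_ge0 _) _ => x; rewrite -!mulmxA norm2_isometry //.
apply: le_trans (norm2_proj_le _ VV) _; apply: le_trans (norm2_mulmx _ _) _.
by rewrite ler_wpM2l ?opnorm_ge0 // norm2_coproj_le.
Qed.

(** r = - V^T M (I - pi) y, and (I - pi) is idempotent. *)
Lemma projected_residual_le : norm2 r <= gamma * eps.
Proof.
have [_ My] := yP; rewrite -(norm2_isometry _ VV) -norm2N.
have -> : - (V *m r) =
    V *m V^T *m M *m (1%:M - V *m V^T) *m ((1%:M - V *m V^T) *m y).
  have -> : r = - (V^T *m (M *m ((1%:M - V *m V^T) *m y))).
    by rewrite /r /H /w !mulmxBl mul1mx !mulmxBr My -!scalemxAr opprB -!mulmxA.
  rewrite mulmxN opprK -!mulmxA; congr (V *m (V^T *m (M *m _))).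
  rewrite !mulmxBl !mul1mx !mulmxBr -!mulmxA (mulmxA V^T V) VV mul1mx.
  by rewrite subrr subr0.
exact: norm2_mulmx.
Qed.

(** Z^T r = (C - mu1) Z^T w, which separation bounds from below. *)
Lemma sep_complement_le :
  sep mu1 (Z^T *m H *m Z) * norm2 (Z^T *m w) <= gamma * eps.
Proof.
apply: le_trans projected_residual_le; have [ZZ _] := ZP.
apply: le_trans (norm2_proj_le r ZZ); apply: le_trans (sigma_min_le _ _) _.
rewrite /r mulmxBr (compression_left_mul _ zP ZP) -scalemxAr.
by rewrite mulmxBl mul_scalar_mx.
Qed.

(** Pairing r with u replaces H by muk exactly, so no expansion in eps is made:
    the second-order term only comes from dividing by dotv u w. *)
Lemma left_eigenvector_le u : unit_left_eigenvector H muk u ->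
  `|mu1 - muk| * `|dotv u w| <= gamma * eps.
Proof.
move=> [u1 Hu]; apply: le_trans projected_residual_le.
rewrite -[leRHS]mul1r -u1; apply: le_trans (cauchy_schwarz u r).
have uH : dotv u (H *m w) = muk * dotv u w.
  by rewrite /dotv mulmxA Hu -scalemxAl mxE.
by rewrite /r !dotv_bilin uH -mulrBl normrM distrC.
Qed.

Lemma alphaE : alpha = dotv z w.
Proof. by rewrite /alpha dotv_mulmxr dotvC. Qed.

(** The components of y along the Ritz vector, along the rest of the Krylov
    space and orthogonally to it. *)
Lemma eigenvector_components :
  alpha ^+ 2 + norm2 (Z^T *m w) ^+ 2 + eps ^+ 2 = 1.
Proof.
have [y1 _] := yP; have [z1 _] := zP.
rewrite alphaE -(complement_basis_norm w z1 ZP) -(pythagoras_proj y VV) y1.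
by rewrite expr1n.
Qed.

Lemma ritz_vector_defect :
  norm2 (V *m z - alpha *: y) ^+ 2 = eps ^+ 2 + norm2 (Z^T *m w) ^+ 2.
Proof.
have -> : eps ^+ 2 + norm2 (Z^T *m w) ^+ 2 = 1 - alpha ^+ 2.
  by rewrite -eigenvector_components; ring.
have [y1 _] := yP; have [z1 _] := zP.
rewrite norm2_sqr !dotv_bilin -norm2_sqr norm2_isometry // z1.
rewrite -(norm2_sqr y) y1 (dotvC (V *m z)) -/alpha; ring.
Qed.

(** Expand w along z and Z: dotv u w is alpha times dotv u z plus a part of size
    at most that of Z^T w. *)
Lemma left_eigenvector_component u : unit_left_eigenvector H muk u ->
  `|alpha| * `|dotv u z| - norm2 (Z^T *m w) <= `|dotv u w|.
Proof.
move=> [u1 _]; have [z1 _] := zP; have [ZZ _] := ZP.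
have wE := complement_basis_decomp w z1 ZP; rewrite -alphaE in wE.
rewrite [X in _ <= `|dotv u X|]wE dotvDr dotvZr -normrM.
have : `|dotv u (Z *m (Z^T *m w))| <= norm2 (Z^T *m w).
  by rewrite -[leRHS]mul1r -u1 -(norm2_isometry (Z^T *m w) ZZ) cauchy_schwarz.
move: (dotv u (Z *m _)) => b; move: (alpha * _) => a bt.
have := lerB_normD a b; lra.
Qed.

End RitzPair.

(** * Second-order bookkeeping *)

Lemma defect_le (R : realFieldType) (e t d : R) :
  0 <= e -> 0 <= t -> 0 <= d -> d ^+ 2 = e ^+ 2 + t ^+ 2 -> d <= e + t.
Proof.
move=> e0 t0 d0 dE; rewrite -(@ler_pXn2r _ 2%N) ?nnegrE ?addr_ge0 // dE.
by rewrite sqrrD addrAC lerDl mulrn_wge0 // mulr_ge0.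
Qed.

Lemma cosine_ge (R : realFieldType) (a d : R) :
  0 <= a -> 0 <= d -> d <= 1 -> a ^+ 2 + d ^+ 2 = 1 -> 1 - d <= a.
Proof. by move=> a0 d0 d1 ad; have a1 : a <= 1; nra. Qed.

(** Here e = eps, t = |Z^T w|, d = |y_k - alpha y|, D = |mu_1 - mu_k|,
    a = |alpha|, b = |u^T w|, c = |u^T z|, so kappa = c^-1. Multiplying
    a c - t <= b by kappa gives kappa b >= 1 - L e with L = 1 + q + K0 q, that is
    D <= kappa g e + L e D. A first use with L e <= 1/2 gives D <= 2 kappa g e;
    feeding this back into the right-hand side makes the excess quadratic. *)
Lemma eigenvalue_error (R : realFieldType) (e t d D a c b g m q K0 : R) :
  0 <= e -> 0 <= t -> 0 <= d -> 0 <= D -> 0 <= a -> 0 < c -> 0 <= q ->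
  0 <= g -> g <= m -> t <= q * e -> d <= (1 + q) * e ->
  a ^+ 2 + d ^+ 2 = 1 -> c^-1 <= K0 -> a * c - t <= b -> D * b <= g * e ->
  (1 + q + K0 * q) * e <= 2^-1 ->
  D <= c^-1 * g * e + 2 * (1 + q + K0 * q) * K0 * m * e ^+ 2.
Proof.
move=> e0 t0 d0 D0 a0 c0 q0 g0 gm tq dq ad cK ab Db Le.
set L := 1 + q + K0 * q in Le *; set x := c^-1 * g * e.
have k0 : 0 < c^-1 by rewrite invr_gt0.
have K00 : 0 <= K0 by lra.
have K0qe : 0 <= K0 * q * e by rewrite !mulr_ge0.
have LE : L * e = (1 + q) * e + K0 * q * e by rewrite /L; ring.
have da : 1 - d <= a by apply: cosine_ge => //; lra.
have kb : 1 - L * e <= c^-1 * b.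
  have /(ler_wpM2l (ltW k0)) := ab.
  rewrite mulrBr mulrCA mulVf ?gt_eqF // mulr1.
  have : c^-1 * t <= K0 * (q * e) by apply: ler_pM => //; exact: ltW.
  rewrite mulrA; lra.
have xb : D * (1 - L * e) <= x.
  have := ler_wpM2l D0 kb; have := ler_wpM2l (ltW k0) Db.
  by rewrite /x !mulrA (mulrC D c^-1) => h1 h2; apply: le_trans h2 h1.
have D2x : D <= 2 * x.
  have : D * 2^-1 <= D * (1 - L * e) by apply: ler_wpM2l => //; lra.
  lra.
have xK : x <= K0 * m * e.
  rewrite /x -!mulrA; apply: ler_pM => //; first exact: ltW.
    by rewrite mulr_ge0.
  by rewrite ler_wpM2r.
have Le0 : 0 <= L * e by rewrite LE !addr_ge0 // mulr_ge0 // addr_ge0.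
have : L * e * D <= L * e * (2 * (K0 * m * e)).
  apply: ler_wpM2l => //; lra.
have -> : L * e * (2 * (K0 * m * e)) = 2 * L * K0 * m * e ^+ 2 by ring.
have : D * (1 - L * e) = D - L * e * D by ring.
lra.
Qed.

(** * The bound for the Arnoldi approximation *)

Theorem theorem5p4 (R : realType) (n : nat) (A : 'M[R]_n) (g : 'cV[R]_n)
    (Delta : R) (sopt : 'cV[R]_n) (lambda_opt mu1 : R) (y : 'cV[R]_(n + n))
    (kappa_max sep_min : R) :
  A^T = A -> g != 0 -> 0 < Delta ->
  tr_solution A g Delta sopt ->
  optimal_multiplier A g Delta sopt lambda_opt ->
  easy_case A g lambda_opt ->
  norm2 sopt = Delta ->
  let M := trs_mx A g Delta in
  rightmost_eigenvalue M mu1 ->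
  unit_right_eigenvector M mu1 y ->
  0 < sep_min ->
  exists C delta : R, 0 < delta /\
    forall (k : nat) (v1 : 'cV[R]_(n + n)) (V : 'M[R]_(n + n, k))
      (muk : R) (z u : 'cV[R]_k) (Zperp : 'M[R]_(k, k.-1)) (sA : 'cV[R]_n),
    norm2 v1 = 1 ->
    \rank (krylov_mx M v1 k) = k ->
    orthonormal_krylov_basis M v1 V ->
    let H := V^T *m M *m V in
    let pi_k := V *m V^T in
    rightmost_eigenvalue H muk ->
    simple_eigenvalue H muk ->
    unit_right_eigenvector H muk z ->
    unit_left_eigenvector H muk u ->
    orthonormal_complement_basis z Zperp ->
    let C_k := Zperp^T *m H *m Zperp in
    let yk := V *m z in
    let y1 := usubmx yk in
    let y2 := dsubmx yk in
    y1 != 0 ->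
    dotv g y2 != 0 ->
    sA = - (Delta ^+ 2 / dotv g y2) *: y1 ->
    sA = - (Num.sg (dotv g y2) * Delta / norm2 y1) *: y1 ->
    norm2 sA = Delta ->
    let eps := sin (angle_subspace y V) in
    let gamma := opnorm (pi_k *m M *m (1%:M - pi_k)) in
    let alpha := dotv y yk in
    let kappa := eig_cond u z in
    let c_k := Delta / norm2 y1 *
      (opnorm (M - muk%:M) *
         (1 + opnorm M / (Num.sqrt (1 - eps ^+ 2) * sep mu1 C_k))
       + `|alpha| * kappa * gamma) in
    0 < sep mu1 C_k ->
    (* the spectral data of H on which C and delta may depend *)
    kappa <= kappa_max ->
    sep_min <= sep mu1 C_k ->
    eps < delta ->
    norm2 ((A + muk%:M) *m sA + g) <= c_k * eps + C * eps ^+ 2.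
Proof.
move=> AT g0 D0 _ opt easy sD M right yP smin0.
have yu0 : 0 < norm2 (usubmx y).
  rewrite norm2_gt0; exact: rightmost_usubmx_neq0 opt easy sD right yP.
pose m := opnorm M; have m0 : 0 <= m := opnorm_ge0 M.
pose q := m / sep_min; have q0 : 0 <= q by rewrite divr_ge0 // ltW.
pose K0 := `|kappa_max|; have K00 : 0 <= K0 := normr_ge0 _.
pose L := 1 + q + K0 * q.
have L1 : 1 + q <= L by rewrite lerDl mulr_ge0.
have L0 : 0 < L by apply: lt_le_trans L1; rewrite ltr_wpDr.
pose B := 2 * L * K0 * m.
have B0 : 0 <= B by rewrite !mulr_ge0 // ltW.
(* delta ensures L eps <= 1/2, so that |alpha| >= 1/2, and L eps <= |y_up| / 4,
   so that |y1| >= |y_up| / 2 - |y_up| / 4, where y_up is the upper half of y;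
   hence Delta / |y1| <= 4 Delta / |y_up|. *)
exists (4 * Delta / norm2 (usubmx y) * B).
exists (Num.min (2 * L)^-1 (norm2 (usubmx y) / (4 * L))); split.
  by rewrite lt_min invr_gt0 divr_gt0 ?mulr_gt0.
move=> k v1 V muk z u Zp sA _ _ [VV _] H pi_k _ simple zP uP ZP C_k yk y1 y2.
move=> y10 gy2 sAE _ sAD eps gamma alpha kappa c_k sep0 kmax smin.
rewrite lt_min => /andP [/ltW eL /ltW eY].
have epsE : eps = norm2 ((1%:M - V *m V^T) *m y) := sin_angle_subspace VV yP.
have e0 : 0 <= eps by rewrite epsE norm2_ge0.
have Le : L * eps <= 2^-1.
  by move: eL; rewrite invfM mulrC -ler_pdivlMl // invrK mulrC.
have LeY : L * eps <= norm2 (usubmx y) / 4.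
  by move: eY; rewrite invfM mulrA ler_pdivlMr // mulrC.
have Ke : (1 + q) * eps <= L * eps by rewrite ler_wpM2r.
have eK : eps <= (1 + q) * eps by rewrite ler_peMl // lerDl.
pose t := norm2 (Zp^T *m (V^T *m y)); have t0 : 0 <= t := norm2_ge0 _.
pose d := norm2 (yk - alpha *: y); have d0 : 0 <= d := norm2_ge0 _.
have gm : gamma <= m := opnorm_coupling_le M VV.
have g_ge0 : 0 <= gamma := opnorm_ge0 _.
have ts : t * sep mu1 C_k <= m * eps.
  apply: le_trans (_ : gamma * eps <= _); last by rewrite ler_wpM2r.
  by rewrite mulrC epsE; exact: sep_complement_le VV yP zP ZP.
have tq : t <= q * eps.
  rewrite /q mulrAC ler_pdivlMr //; apply: le_trans ts.
  by rewrite ler_wpM2l.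
have dE : d ^+ 2 = eps ^+ 2 + t ^+ 2.
  by rewrite epsE; exact: ritz_vector_defect VV yP zP ZP.
have det : d <= eps + t by exact: defect_le.
have dq : d <= (1 + q) * eps by rewrite mulrDl mul1r; lra.
have ad : `|alpha| ^+ 2 + d ^+ 2 = 1.
  rewrite real_normK ?num_real // dE -(eigenvector_components VV yP zP ZP).
  by rewrite -epsE -/t -/alpha; ring.
have uz0 : 0 < `|dotv u z|.
  by rewrite normr_gt0; exact: simple_left_right_neq0 simple zP uP ZP.
have muD : `|mu1 - muk| <= kappa * gamma * eps + B * eps ^+ 2.
  apply: (@eigenvalue_error _ eps t d _ `|alpha| _ `|dotv u (V^T *m y)|) => //.
  - by apply: le_trans kmax _; exact: ler_norm.
  - exact: (left_eigenvector_component y zP ZP uP).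
  - by rewrite epsE; exact: (left_eigenvector_le VV yP uP).
have al : 1 - d <= `|alpha| by apply: cosine_ge => //; lra.
have al1 : `|alpha| <= 1 by have := sqr_ge0 d; nra.
have y1ge : norm2 (usubmx y) / 4 <= norm2 y1.
  have : norm2 (alpha *: usubmx y - y1) <= d.
    by rewrite -norm2N opprB /y1 -linearZ -linearB norm2_usubmx.
  have := norm2_sub_le (alpha *: usubmx y) y1.
  rewrite norm2Z; have : 2^-1 <= `|alpha| by lra.
  by move=> /(ler_wpM2r (ltW yu0)); lra.
have y1pos : 0 < norm2 y1 by rewrite norm2_gt0.
have dc : d <= eps * (1 + m / (Num.sqrt (1 - eps ^+ 2) * sep mu1 C_k)).
  apply: le_trans det _; rewrite mulrDr mulr1 lerD2l mulrA ler_pdivlMr; last first.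
    by rewrite mulr_gt0 // sqrtr_gt0; nra.
  rewrite mulrCA [eps * m]mulrC; apply: le_trans ts.
  rewrite ler_piMl ?mulr_ge0 ?(ltW sep0) //.
  by rewrite -[leRHS]sqrtr1 ler_wsqrtr // gerBl sqr_ge0.
apply: le_trans (arnoldi_residual A muk D0 y10 gy2 sAE sAD) _.
have res : norm2 ((M - muk%:M) *m yk) <=
    `|alpha| * `|mu1 - muk| + opnorm (M - muk%:M) * d.
  have -> : yk = alpha *: y + (yk - alpha *: y) by rewrite addrC subrK.
  rewrite mulmxDr; apply: le_trans (norm2D _ _) _; apply: lerD; last first.
    exact: norm2_mulmx.
  have [y1' My] := yP.
  rewrite -scalemxAr norm2Z mulmxBl mul_scalar_mx My -scalerBl norm2Z y1'.
  by rewrite mulr1.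
have scale_le x : 0 <= x ->
    Delta / norm2 y1 * x <= 4 * Delta / norm2 (usubmx y) * x.
  move=> x0; rewrite ler_wpM2r // ler_pdivrMr // mulrAC ler_pdivlMr //.
  have := ler_wpM2l (ltW D0) y1ge; lra.
have Be : 0 <= B * eps ^+ 2 by rewrite mulr_ge0 // sqr_ge0.
have aD : `|alpha| * `|mu1 - muk| <=
    `|alpha| * kappa * gamma * eps + B * eps ^+ 2.
  apply: le_trans (ler_wpM2l (normr_ge0 _) muD) _.
  by rewrite mulrDr lerD ?ler_piMl // !mulrA.
have Md := ler_wpM2l (opnorm_ge0 (M - muk%:M)) dc.
have Dy : 0 <= Delta / norm2 y1 by rewrite divr_ge0 // ltW.
have := scale_le _ Be; rewrite [in leRHS]mulrA => Bscale.
apply: le_trans (lerD (lexx _) Bscale).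
rewrite /c_k -[_ * eps]mulrA -mulrDr; apply: ler_wpM2l => //.
apply: le_trans res _; rewrite -/m.
move: Md aD; set E := 1 + _ => Md aD.
rewrite mulrDl -[_ * E * eps]mulrA (mulrC E); lra.
Qed.
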